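(* Let $G$ be a subgroup of the symmetric group $S_m$, let $U$ and $V$ be unitary spaces, let $\mathfrak{X}$ be an irreducible unitary representation of $G$ over $U$, and let $S, T\in\mathrm{End}(V)$. Then $K^{\mathfrak{X}}(T)^{*}=K^{\mathfrak{X}}(T^{*})$, and $K^{\mathfrak{X}}(T)$ is (a) normal, (b) unitary, (c) Hermitian, (d) skew-Hermitian, (e) positive semidefinite, or (f) positive definite if and only if $T$ has the corresponding property.
   Context: A unitary space is a finite-dimensional complex vector space equipped with an inner product; $\mathrm{End}(V)$ is the set of linear operators on $V$, and $^*$ denotes the adjoint. A unitary representation of $G$ over $U$ is a group homomorphism from $G$ to the unitary operators on $U$. $\times^{m}V$ is the Cartesian product of $m$ copies of $V$; $U\otimes\times^{m}V$ carries the inner product determined by $\langle u\otimes x^\times, v\otimes y^\times\rangle=\langle u,v\rangle\sum_{i=1}^m\langle x_i,y_i\rangle$ for $u,v\in U$, $x^\times=(x_1,\dots,x_m)$, $y^\times=(y_1,\dots,y_m)\in\times^m V$. For $\sigma\in G$, $Q(\sigma)(v_1,\dots,v_m)=(v_{\sigma^{-1}(1)},\dots,v_{\sigma^{-1}(m)})$ on $\times^m V$, and $C_{\mathfrak{X}}=\frac{1}{|G|}\sum_{\sigma\in G}\mathfrak{X}(\sigma)\otimes Q(\sigma)$. The generalized Cartesian symmetry class is the range $V^{\mathfrak{X}}(G)=C_{\mathfrak{X}}(U\otimes\times^m V)$, with the inner product inherited from $U\otimes\times^m V$. For $T\in\mathrm{End}(V)$, $(\times^mT)(v_1,\dots,v_m)=(Tv_1,\dots,Tv_m)$.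 The operator $I\otimes\times^mT$ commutes with $C_{\mathfrak{X}}$, so it leaves $V^{\mathfrak{X}}(G)$ invariant; its restriction to $V^{\mathfrak{X}}(G)$ is denoted $K^{\mathfrak{X}}(T)$.
   Formalization: The ''only if'' half is stated under the extra condition that V = 0 whenever the symmetry class is 0; it fails otherwise (G = S_3, sign representation: the class is 0, so K(T) has all six properties for every T). The adjoint identity and the ''if'' half need no such condition. *)

(* Defs.v *)
From HB Require Import structures.
From mathcomp Require Import all_boot all_order all_fingroup all_algebra.
From mathcomp Require Import ring reals complex.

Set Implicit Arguments.
Unset Strict Implicit.
Unset Printing Implicit Defensive.

Import Order.TTheory GRing.Theory Num.Theory Num.Def.
Import VectorInternalTheory.
Local Open Scope ring_scope.

(* The inner product is linear in its first argument and conjugate-linear in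
   the second one, as in {dot V for conjC}. *)
HB.mixin Record hasInnerProduct (C : numClosedFieldType) V of Vector C V := {
  innerprod : {dot V for @conjC C}
}.

#[short(type="unitarySpaceType")]
HB.structure Definition UnitarySpace (C : numClosedFieldType) :=
  { V of hasInnerProduct C V & Vector C V }.

Notation "''[' u , v ]" := (innerprod u%R v%R) : ring_scope.

Section MakeDot.
Variables (C : numClosedFieldType) (V : lmodType C) (f : V -> V -> C).
Hypothesis f_lin : forall v a u u', f (a *: u + u') v = a * f u v + f u' v.
Hypothesis f_herm : forall u v, f u v = (f v u)^*.
Hypothesis f_pos : forall u, u != 0 -> 0 < f u u.

Let f_bilinear : bilinear_for ( *%R) (conjC \; *%R) f.
Proof.
split=> [v a u u'|u a v v']; first exact: f_lin.
by rewrite /= f_herm f_lin rmorphD rmorphM /= -!f_herm.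
Qed.
Let f_herm' u v : f u v = (-1) ^+ false * conjC (f v u).
Proof. by rewrite mul1r. Qed.

HB.instance Definition _ :=
  bilinear_isBilinear.Build C V V C ( *%R) (conjC \; *%R) f f_bilinear.
HB.instance Definition _ :=
  isHermitianSesquilinear.Build C V false conjC f f_herm'.
HB.instance Definition _ := isDotProduct.Build C V f f_pos.
Definition mk_dot : {dot V for conjC} := f.
End MakeDot.

Section Adjoint.
Variables (C : numClosedFieldType) (V : unitarySpaceType C).

Lemma innerprodP a (u u' v : V) : '[a *: u + u', v] = a * '[u, v] + '[u', v].
Proof. exact: linearPl. Qed.

Lemma innerprodC (u v : V) : '[u, v] = '[v, u]^*.
Proof. by rewrite (hermC innerprod) mul1r. Qed.

Lemma innerprod_gt0 (u : V) : u != 0 -> 0 < '[u, u].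
Proof. exact: neq0_dnorm_gt0. Qed.

Lemma innerprod_injr (v v' : V) : (forall u, '[u, v] = '[u, v']) -> v = v'.
Proof.
move=> eqv; apply/eqP; rewrite -subr_eq0; apply: contraTT isT => /innerprod_gt0.
by rewrite linearBr /= eqv subrr ltxx.
Qed.

Definition gram : 'M[C]_(dim V) :=
  \matrix_(i, j) '[r2v 'e_i : V, r2v 'e_j : V].

Lemma innerprod_sum I (r : seq I) (a : I -> C) (x : I -> V) J (s : seq J)
    (b : J -> C) (y : J -> V) :
  '[\sum_(i <- r) a i *: x i, \sum_(j <- s) b j *: y j] =
    \sum_(i <- r) \sum_(j <- s) a i * (b j)^* * '[x i, y j].
Proof.
rewrite linear_sumlz /=; apply: eq_bigr => i _.
rewrite linear_sumr /=; apply: eq_bigr => j _.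
by rewrite linearZl_LR linearZr_LR /= mulrA.
Qed.

Lemma v2r_sum (u : V) : u = \sum_i v2r u 0 i *: r2v 'e_i.
Proof.
rewrite -{1}(v2rK u) {1}(row_sum_delta (v2r u)) linear_sum.
by apply: eq_bigr => i _; rewrite linearZ.
Qed.

Lemma innerprod_gram (u v : V) :
  '[u, v] = (v2r u *m gram *m (v2r v)^t*%sesqui) 0 0.
Proof.
rewrite {1}(v2r_sum u) {1}(v2r_sum v) innerprod_sum -mulmxA mxE.
apply: eq_bigr => i _; rewrite mxE big_distrr; apply: eq_bigr => j _ /=.
by rewrite !mxE [in RHS](mulrC '[_, _]) mulrA.
Qed.

Lemma v2r_lfun (T : 'End(V)) u : v2r (T u) = v2r u *m f2mx T.
Proof. by rewrite unlock /= r2vK. Qed.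

Lemma gram_herm : (gram^t*)%sesqui = gram.
Proof. by apply/matrixP => i j; rewrite !mxE -innerprodC. Qed.

Lemma gram_unit : gram \in unitmx.
Proof.
rewrite -row_free_unit -kermx_eq0; apply/eqP/row_matrixP => i.
rewrite row0; set u := row i _; apply/eqP; rewrite -(inj_eq (@r2v_inj _ _)) linear0.
apply: contraTT isT => /innerprod_gt0; rewrite innerprod_gram r2vK.
have -> : u *m gram = 0 by rewrite /u -row_mul mulmx_ker row0.
by rewrite mul0mx mxE ltxx.
Qed.

Lemma adjoint_exists (T : 'End(V)) :
  {S : 'End(V) | forall u v, '[T u, v] = '[u, S v]}.
Proof.
exists (Hom ((invmx gram *m f2mx T *m gram)^t*)%sesqui) => u v.
rewrite !innerprod_gram !v2r_lfun /= trmx_mul map_mxM trmxCK.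
by rewrite !mulmxA mulmxK ?gram_unit.
Qed.

Definition adjoint (T : 'End(V)) : 'End(V) := sval (adjoint_exists T).

Lemma adjointP (T : 'End(V)) u v : '[T u, v] = '[u, adjoint T v].
Proof. exact: (svalP (adjoint_exists T)). Qed.

Lemma adjoint_unique (T S : 'End(V)) :
  (forall u v, '[T u, v] = '[u, S v]) -> S = adjoint T.
Proof.
move=> TS; apply/lfunP => v; apply: innerprod_injr => u.
by rewrite -adjointP TS.
Qed.

Lemma gram_diag : exists2 P : 'M[C]_(dim V), P \in unitmx &
  exists2 d : 'rV[C]_(dim V), forall i, 0 < d 0 i &
    gram = P^t*%sesqui *m diag_mx d *m P.
Proof.
have gramH : gram \is hermsymmx.
  by apply/is_hermitianmxP; rewrite expr0 scale1r gram_herm.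
have /orthomx_spectralP eqG := hermitian_normalmx gramH.
set P := spectralmx gram in eqG; set d := spectral_diag gram in eqG.
have Pu : P \is unitarymx := spectral_unitarymx _.
have Punit := unitarymx_unit Pu.
exists P => //; exists d; last by rewrite -invmx_unitary.
move=> i; have Prow : row i P *m P^t*%sesqui = 'e_i.
  by rewrite -row_mul (unitarymxP Pu) row1.
have Prow0 : r2v (row i P) != 0 :> V.
  apply/eqP => /(congr1 v2r); rewrite r2vK linear0 => P0; move: Prow.
  rewrite P0 mul0mx => /matrixP/(_ 0 i); rewrite !mxE !eqxx => /eqP.
  by rewrite eq_sym oner_eq0.
have Pcol : P *m (row i P)^t*%sesqui = delta_mx i 0.
  have := congr1 (fun M : 'rV_(dim V) => (M^t*)%sesqui) Prow.
  by rewrite trmx_mul map_mxM trmxCK trmx_delta map_delta_mx.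
move: (innerprod_gt0 Prow0); rewrite innerprod_gram r2vK eqG invmx_unitary //.
rewrite !mulmxA Prow -(mulmxA _ P) Pcol -rowE -colE !mxE eqxx mulr1n.
by [].
Qed.

End Adjoint.

Section Predicates.
Variables (C : numClosedFieldType) (V : unitarySpaceType C).
Implicit Type T : 'End(V).

Definition op_normal T := (T \o adjoint T = adjoint T \o T)%VF.
Definition op_unitary T := (adjoint T \o T = \1)%VF.
Definition op_hermitian T := adjoint T = T.
Definition op_skew_hermitian T := adjoint T = - T.
Definition op_psd T := op_hermitian T /\ forall v : V, 0 <= '[T v, v].
Definition op_pd T := op_hermitian T /\ forall v : V, v != 0 -> 0 < '[T v, v].

End Predicates.

(* The m-fold Cartesian product of V is {ffun 'I_m -> V}. *)
Section FfunInnerProduct.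
Variables (C : numClosedFieldType) (I : finType) (V : unitarySpaceType C).
Implicit Types x y : {ffun I -> V}.

Definition ffun_innerprod x y : C := \sum_i '[x i, y i].

Lemma ffun_innerprod_linear y a x x' :
  ffun_innerprod (a *: x + x') y =
  a * ffun_innerprod x y + ffun_innerprod x' y.
Proof.
rewrite /ffun_innerprod mulr_sumr -big_split; apply: eq_bigr => i _ /=.
by rewrite !ffunE innerprodP.
Qed.

Lemma ffun_innerprod_herm x y : ffun_innerprod x y = (ffun_innerprod y x)^*.
Proof.
by rewrite /ffun_innerprod rmorph_sum; apply: eq_bigr => i _; rewrite innerprodC.
Qed.

Lemma ffun_innerprod_gt0 x : x != 0 -> 0 < ffun_innerprod x x.
Proof.
move=> x0; have xge0 i : 0 <= '[x i, x i] by exact: dnorm_ge0.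
rewrite lt_def sumr_ge0 // andbT; apply: contraNneq x0.
move/eqP; rewrite psumr_eq0 // => /allP xi0; apply/eqP/ffunP => i; rewrite ffunE.
by apply/eqP; rewrite -(dnorm_eq0 innerprod); apply: xi0 (mem_index_enum i).
Qed.

HB.instance Definition _ := hasInnerProduct.Build C {ffun I -> V}
  (mk_dot ffun_innerprod_linear ffun_innerprod_herm ffun_innerprod_gt0).

End FfunInnerProduct.

Section SubspaceInnerProduct.
Variables (C : numClosedFieldType) (V : unitarySpaceType C) (W : {vspace V}).
Implicit Types x y : subvs_of W.

Definition subvs_innerprod x y : C := '[vsval x, vsval y].

Lemma subvs_innerprod_linear y a x x' :
  subvs_innerprod (a *: x + x') y =
  a * subvs_innerprod x y + subvs_innerprod x' y.
Proof. by rewrite /subvs_innerprod linearP innerprodP. Qed.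

Lemma subvs_innerprod_herm x y : subvs_innerprod x y = (subvs_innerprod y x)^*.
Proof. exact: innerprodC. Qed.

Lemma subvs_innerprod_gt0 x : x != 0 -> 0 < subvs_innerprod x x.
Proof. by move=> x0; apply: innerprod_gt0. Qed.

HB.instance Definition _ := hasInnerProduct.Build C (subvs_of W)
  (mk_dot subvs_innerprod_linear subvs_innerprod_herm subvs_innerprod_gt0).

End SubspaceInnerProduct.

(* The tensor product of U and W, in the coordinates given by the bijections
   v2r : U -> 'rV_(dim U) and v2r : W -> 'rV_(dim W): the entry (i, j) is the
   coefficient of r2v 'e_i (x) r2v 'e_j. *)
Definition tensor (C : numClosedFieldType) (U W : vectType C) :=
  'M[C]_(dim U, dim W).
HB.instance Definition _ (C : numClosedFieldType) (U W : vectType C) :=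
  Vector.on (tensor U W).

Section Tensor.
Variables (C : numClosedFieldType) (U W : vectType C).

Definition tens (u : U) (w : W) : tensor U W := (v2r u)^T *m v2r w.

Lemma tens_linearl w : linear (tens^~ w).
Proof. by move=> a u u'; rewrite /tens !linearP mulmxDl -scalemxAl. Qed.

Lemma tens_linearr u : linear (tens u).
Proof. by move=> a w w'; rewrite /tens !linearP. Qed.

Lemma tensE u w i j : tens u w i j = v2r u 0 i * v2r w 0 j.
Proof. by rewrite mxE big_ord1 !mxE. Qed.

Lemma tens_sum (A : tensor U W) :
  A = \sum_i \sum_j A i j *: tens (r2v 'e_i) (r2v 'e_j).
Proof.
rewrite {1}[A]matrix_sum_delta; apply: eq_bigr => i _; apply: eq_bigr => j _.
by rewrite /tens !r2vK trmx_delta mul_delta_mx.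
Qed.

Definition tens_op (f : 'End(U)) (g : 'End(W)) : 'End(tensor U W) :=
  linfun (mulmxr (f2mx g) \o mulmx (f2mx f)^T).

Lemma tens_opE f g u w : tens_op f g (tens u w) = tens (f u) (g w).
Proof.
rewrite lfunE /= /tens; have lfunM (X : vectType C) (h : 'End(X)) x :
  v2r (h x) = v2r x *m f2mx h by rewrite unlock /= r2vK.
by rewrite !lfunM trmx_mul !mulmxA.
Qed.

Lemma tens_op_comp f f' g g' :
  (tens_op f g \o tens_op f' g' = tens_op (f \o f') (g \o g'))%VF.
Proof.
apply/lfunP => A; rewrite [A]tens_sum !linear_sum; apply: eq_bigr => i _.
rewrite !linear_sum; apply: eq_bigr => j _; rewrite !linearZ /=; congr (_ *: _).
by rewrite lfunE /= !tens_opE !lfunE.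
Qed.

End Tensor.

Section TensorInnerProduct.
Variables (C : numClosedFieldType) (U W : unitarySpaceType C).
Implicit Types A B : tensor U W.

(* The sesquilinear extension of <u (x) w, u' (x) w'> = <u, u'> <w, w'>. *)
Definition tens_innerprod A B : C :=
  \sum_i \sum_j \sum_k \sum_l A i j * (B k l)^* *
    ('[r2v 'e_i : U, r2v 'e_k] * '[r2v 'e_j : W, r2v 'e_l]).

Lemma tens_innerprodE A B : tens_innerprod A B =
  \tr ((gram U)^T *m A *m gram W *m B^t*%sesqui).
Proof.
rewrite /tens_innerprod; under eq_bigr do rewrite exchange_big /=.
rewrite exchange_big /=; apply: eq_bigr => k _; rewrite mxE.
under eq_bigr do rewrite exchange_big /=.
rewrite exchange_big /=; apply: eq_bigr => l _; rewrite !mxE mulr_suml.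
rewrite exchange_big /=; apply: eq_bigr => j _; rewrite !mxE !mulr_suml.
apply: eq_bigr => i _; rewrite !mxE; ring.
Qed.

Lemma tens_innerprod_linear B a A A' :
  tens_innerprod (a *: A + A') B =
  a * tens_innerprod A B + tens_innerprod A' B.
Proof.
rewrite !tens_innerprodE mulmxDr !mulmxDl linearD /=.
by rewrite -scalemxAr -!scalemxAl linearZ.
Qed.

Lemma tens_innerprod_herm A B : tens_innerprod A B = (tens_innerprod B A)^*.
Proof.
rewrite !tens_innerprodE; set M := _ *m (A^t*)%sesqui.
have <- : \tr (M^t*)%sesqui = (\tr M)^*.
  by rewrite rmorph_sum; apply: eq_bigr => i _; rewrite !mxE.
have gU : map_mx conjC (gram U) = (gram U)^T.
  by rewrite -[in RHS]gram_herm map_trmx trmxK.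
by rewrite !trmx_mul !map_mxM trmxCK gram_herm trmxK gU !mulmxA
  [RHS]mxtrace_mulC !mulmxA.
Qed.

Lemma tens_innerprod_gt0 A : A != 0 -> 0 < tens_innerprod A A.
Proof.
move=> A0; have [Q Qu [e e0 gU]] := gram_diag U.
have [P Pu [d d0 gW]] := gram_diag W.
pose Q' := map_mx conjC Q; pose B := Q' *m A *m (P^t*)%sesqui.
have Q'u : Q' \in unitmx by rewrite map_unitmx.
have P'u : (P^t*)%sesqui \in unitmx by rewrite map_unitmx unitmx_tr.
have B0 : B != 0.
  apply: contraNneq A0 => B0; apply/eqP.
  by rewrite -(mulKmx Q'u A) -(mulmxK P'u (Q' *m A)) -/B B0 mul0mx mulmx0.
have gUT : (gram U)^T = (Q'^t*)%sesqui *m diag_mx e *m Q'.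
  rewrite gU !trmx_mul tr_diag_mx map_trmx mulmxA; congr (_ *m _ *m _).
    by apply/matrixP => i j; rewrite !mxE conjCK.
  by apply/matrixP => i j; rewrite !mxE.
have -> : tens_innerprod A A = \sum_i \sum_j e 0 i * d 0 j * `|B i j| ^+ 2.
  rewrite tens_innerprodE gUT gW -!mulmxA mxtrace_mulC !mulmxA.
  have -> : diag_mx e *m Q' *m A *m (P^t*)%sesqui *m diag_mx d *m P *m
      (A^t*)%sesqui *m (Q'^t*)%sesqui =
      diag_mx e *m B *m diag_mx d *m (B^t*)%sesqui.
    by rewrite /B !trmx_mul !map_mxM trmxCK !mulmxA.
  apply: eq_bigr => i _; rewrite mxE; apply: eq_bigr => j _.
  by rewrite mul_mx_diag mul_diag_mx !mxE normCK; ring.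
have tge0 i j : 0 <= e 0 i * d 0 j * `|B i j| ^+ 2.
  by rewrite !mulr_ge0 ?exprn_ge0 // ltW.
rewrite lt_def sumr_ge0 ?andbT => [|i _]; last exact: sumr_ge0.
apply: contraNneq B0 => /eqP; rewrite psumr_eq0 => [|i _]; last exact: sumr_ge0.
move/allP => sum0; apply/eqP/matrixP => i j; rewrite [RHS]mxE; apply/eqP.
have := sum0 i (mem_index_enum i); rewrite /= psumr_eq0 // => /allP.
move=> /(_ j (mem_index_enum j)); rewrite /= mulf_eq0 expf_eq0 normr_eq0.
by rewrite mulf_eq0 (gt_eqF (e0 i)) (gt_eqF (d0 j)).
Qed.

HB.instance Definition _ := hasInnerProduct.Build C (tensor U W)
  (mk_dot tens_innerprod_linear tens_innerprod_herm tens_innerprod_gt0).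

Lemma innerprod_tens (u u' : U) (w w' : W) :
  '[tens u w, tens u' w'] = '[u, u'] * '[w, w'].
Proof.
have -> : '[tens u w, tens u' w'] = tens_innerprod (tens u w) (tens u' w') by [].
rewrite tens_innerprodE !innerprod_gram /tens trmx_mul map_mxM trmxK.
set x := v2r u; set x' := v2r u'; set y := v2r w; set y' := v2r w'.
have -> : (gram U)^T *m (x^T *m y) *m gram W *m
    ((y'^t*)%sesqui *m map_mx conjC x') =
    ((gram U)^T *m x^T) *m ((y *m gram W *m (y'^t*)%sesqui) *m map_mx conjC x').
  by rewrite !mulmxA.
rewrite mxtrace_mulC -(mulmxA (y *m _ *m _) (map_mx conjC x')).
have -> : map_mx conjC x' *m ((gram U)^T *m x^T) =
    (x *m gram U *m (x'^t*)%sesqui)^T.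
  by rewrite !trmx_mul map_trmx trmxK.
by rewrite /mxtrace big_ord1 mxE big_ord1 mulrC [_^T _ _]mxE.
Qed.

End TensorInnerProduct.

Section Representation.
Variables (C : numClosedFieldType) (m : nat) (G : {group 'S_m}).
Variables (U : unitarySpaceType C) (X : 'S_m -> 'End(U)).

(* In 'S_m, (s * t) i = t (s i): the product s * t is the composite of
   functions "t after s", so the first condition says that X turns composition
   in G into composition of operators. Values of X outside G play no role;
   X 1 = \1 follows from the two conditions. *)
Definition unitary_repr :=
  {in G &, forall s t, X (s * t)%g = (X t \o X s)%VF} /\
  {in G, forall s, op_unitary (X s)}.

Definition irreducible_repr :=
  fullv != 0%VS :> {vspace U} /\
  forall W : {vspace U}, {in G, forall s, (X s @: W <= W)%VS} ->
    W = 0%VS \/ W = fullv.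

End Representation.

Section CartesianSymmetryClass.
Variables (C : numClosedFieldType) (m : nat) (G : {group 'S_m}).
Variables (U V : unitarySpaceType C) (X : 'S_m -> 'End(U)).

Definition cart_perm (s : 'S_m) : 'End({ffun 'I_m -> V}) :=
  linfun (fun v : {ffun 'I_m -> V} => [ffun i => v (s^-1%g i)]).

Lemma cart_permE s v i : cart_perm s v i = v (s^-1%g i).
Proof.
have lin : linear (fun v : {ffun 'I_m -> V} => [ffun i => v (s^-1%g i)]).
  by move=> a w w'; apply/ffunP => j; rewrite !ffunE.
pose f : {linear {ffun 'I_m -> V} -> {ffun 'I_m -> V}} := HB.pack
  (fun v : {ffun 'I_m -> V} => [ffun i => v (s^-1%g i)])
  (GRing.isLinear.Build _ _ _ _ _ lin).
by rewrite (lfunE f) ffunE.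
Qed.

Definition cart_op (T : 'End(V)) : 'End({ffun 'I_m -> V}) :=
  linfun (fun v : {ffun 'I_m -> V} => [ffun i => T (v i)]).

Lemma cart_opE T v i : cart_op T v i = T (v i).
Proof.
have lin : linear (fun v : {ffun 'I_m -> V} => [ffun i => T (v i)]).
  by move=> a w w'; apply/ffunP => j; rewrite !ffunE linearP.
pose f : {linear {ffun 'I_m -> V} -> {ffun 'I_m -> V}} := HB.pack
  (fun v : {ffun 'I_m -> V} => [ffun i => T (v i)])
  (GRing.isLinear.Build _ _ _ _ _ lin).
by rewrite (lfunE f) ffunE.
Qed.

Definition symmetrizer : 'End(tensor U {ffun 'I_m -> V}) :=
  #|G|%:R^-1 *: \sum_(s in G) tens_op (X s) (cart_perm s).

Definition symmetry_class : {vspace tensor U {ffun 'I_m -> V}} :=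
  limg symmetrizer.

Lemma symmetrizer_comm T :
  (symmetrizer \o tens_op \1 (cart_op T) =
   tens_op \1 (cart_op T) \o symmetrizer)%VF.
Proof.
rewrite /symmetrizer -comp_lfunZl -comp_lfunZr; congr (_ *: _).
apply/lfunP => A; rewrite !lfunE /= !sum_lfunE linear_sum.
apply: eq_bigr => s _; have := congr1 (fun f : 'End(_) => f A) (tens_op_comp
  (X s) \1 (cart_perm s) (cart_op T)).
rewrite lfunE /= => ->; rewrite comp_lfun1r.
have -> : (cart_perm s \o cart_op T = cart_op T \o cart_perm s)%VF.
  by apply/lfunP => v; apply/ffunP => i; rewrite !lfunE /= !(cart_permE, cart_opE).
by rewrite -{1}[X s]comp_lfun1l -tens_op_comp lfunE.
Qed.

(* The restriction of I (x) (x^m T) to the symmetry class. *)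
Definition induced_op (T : 'End(V)) : 'End(subvs_of symmetry_class) :=
  linfun (vsproj symmetry_class \o tens_op \1 (cart_op T) \o vsval).

Lemma induced_opE T x :
  vsval (induced_op T x) = tens_op \1 (cart_op T) (vsval x).
Proof.
rewrite lfunE /= vsprojK //; have /memv_imgP[A _ ->] := subvsP x.
have /(congr1 (fun f : 'End(_) => f A)) := symmetrizer_comm T.
by rewrite !comp_lfunE => <-; rewrite memv_img ?memvf.
Qed.

End CartesianSymmetryClass.

(* Main.v *)
Require Import Defs.
From mathcomp Require Import all_boot all_order all_fingroup all_algebra.
From mathcomp Require Import reals complex.

Set Implicit Arguments.
Unset Strict Implicit.
Unset Printing Implicit Defensive.

Import Order.TTheory GRing.Theory Num.Theory Num.Def.
Import VectorInternalTheory.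
Local Open Scope ring_scope.

(** Write K(T) for [induced_op G X T], W for the symmetry class and C for the
    symmetrizer.

    The operator 1 (x) (x^m T) is, up to an isometry, an orthogonal direct sum
    of copies of T: split U along an orthogonal basis and x^m V along its m
    factors. Taking adjoints and preserving (semi)definiteness are therefore
    inherited from T, and they pass to the invariant subspace W, whose inner
    product is the restricted one. Together with K(ST) = K(S)K(T) and K(1) = 1
    this makes K a unital homomorphism compatible with adjoints, and every
    property of T in the theorem is transmitted to K(T).

    For the converse one finds a copy of V inside W on which K(T) acts as T.
    For u in U and a position i, let v_i denote the tuple with v in position i
    and 0 elsewhere, and put z(v) = C(u (x) v_i). Since Q(s) v_i = v_{s(i)},
    z(v) = sum_j a_j (x) v_j with vectors a_j of U that depend on u and i only.
    So <z(v), z(w)> = (sum_j |a_j|^2) <v, w>, while K(T) z(v) = z(Tv) because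
    1 (x) (x^m T) commutes with C. If W is not 0 then C does not vanish on all
    the u (x) v_i, which span; hence the factor sum_j |a_j|^2 is positive for a
    suitable choice of u and i ([scaled_isometry_into_class]). If W is 0, then V
    is 0 by hypothesis and z = 0 will do. Such a z makes K injective, which
    reflects the four properties that are equations between polynomials in T
    and its adjoint, and it carries the quadratic form of K(T) back to a
    positive multiple of that of T. *)

(** * Inner products *)

Section InnerproductSums.
Variables (C : numClosedFieldType) (V : unitarySpaceType C).

Lemma innerprod_suml I (r : seq I) (x : I -> V) v :
  '[\sum_(i <- r) x i, v] = \sum_(i <- r) '[x i, v].
Proof. exact: linear_sumlz. Qed.

Lemma innerprod_sumr I (r : seq I) (y : I -> V) v :
  '[v, \sum_(i <- r) y i] = \sum_(i <- r) '[v, y i].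
Proof. exact: linear_sumr. Qed.

Lemma innerprod0l (v : V) : '[0, v] = 0.
Proof. exact: linear0l. Qed.

Lemma innerprod0r (v : V) : '[v, 0] = 0.
Proof. exact: linear0r. Qed.

Lemma adjoint1 : adjoint (\1 : 'End(V)) = \1%VF.
Proof. by symmetry; apply: adjoint_unique => u v; rewrite !id_lfunE. Qed.

End InnerproductSums.

(** * Operators on a tensor product *)

Section TensorLinearity.
Variables (C : numClosedFieldType) (U W : vectType C).

Lemma tens_suml I (r : seq I) (P : pred I) (x : I -> U) (w : W) :
  tens (\sum_(i <- r | P i) x i) w = \sum_(i <- r | P i) tens (x i) w.
Proof. by rewrite /tens !linear_sum mulmx_suml. Qed.

Lemma tens_sumr I (r : seq I) (P : pred I) (u : U) (y : I -> W) :
  tens u (\sum_(i <- r | P i) y i) = \sum_(i <- r | P i) tens u (y i).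
Proof. by rewrite /tens linear_sum mulmx_sumr. Qed.

Lemma tensZl a (u : U) (w : W) : tens (a *: u) w = a *: tens u w.
Proof. by rewrite /tens !linearZ -scalemxAl. Qed.

Lemma tens0l (w : W) : tens (0 : U) w = 0.
Proof. by rewrite /tens !linear0 mul0mx. Qed.

Lemma tens0r (u : U) : tens u (0 : W) = 0.
Proof. by rewrite /tens linear0 mulmx0. Qed.

Lemma eq_tens_op (f g : 'End(tensor U W)) :
  (forall u w, f (tens u w) = g (tens u w)) -> f = g.
Proof.
move=> fg; apply/lfunP => A; rewrite [A]tens_sum !linear_sum.
apply: eq_bigr => i _; rewrite !linear_sum; apply: eq_bigr => j _.
by rewrite !linearZ /= fg.
Qed.

End TensorLinearity.

Section TensorGeometry.
Variables (C : numClosedFieldType) (U W : unitarySpaceType C).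

Lemma adjoint_tens_op (f : 'End(U)) (g : 'End(W)) :
  adjoint (tens_op f g) = tens_op (adjoint f) (adjoint g).
Proof.
symmetry; apply: adjoint_unique => A B.
(* It suffices to compare both sides on pure tensors of basis vectors. *)
have sumE (h : 'End(tensor U W)) D : h D =
    \sum_p D p.1 p.2 *: h (tens (r2v 'e_p.1) (r2v 'e_p.2)).
  rewrite {1}[D]tens_sum pair_big (linear_sum h).
  by apply: eq_bigr => p _; rewrite linearZ.
rewrite (sumE _ A) (sumE _ B) {1}[B]tens_sum {2}[A]tens_sum !pair_big.
rewrite !innerprod_sum; apply: eq_bigr => p _; apply: eq_bigr => q _.
by rewrite !tens_opE !innerprod_tens !adjointP.
Qed.

(** This writes U (x) W as an orthogonal direct sum of scaled copies of W. If
    P^* diag(d) P is the Gram matrix of U, the rows of the inverse of P^* are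
    the coordinates of an orthogonal basis e, with squared lengths d. *)
Lemma orthogonal_tens_decomposition : exists2 e : 'I_(dim U) -> U,
  (forall i j, i != j -> '[e i, e j] = 0) &
  forall A : tensor U W, exists w, A = \sum_i tens (e i) (w i).
Proof.
have [P Pu [d _ gramE]] := gram_diag U.
have PHu : (P^t*)%sesqui \in unitmx by rewrite map_unitmx unitmx_tr.
pose Q := invmx (P^t*)%sesqui.
have QP : Q *m (P^t*)%sesqui = 1%:M by rewrite mulVmx.
have PQ : P *m (Q^t*)%sesqui = 1%:M.
  by rewrite -[P in LHS]trmxCK -map_mxM -trmx_mul QP trmx1 map_mx1.
exists (fun i => r2v (row i Q)) => [i j neq_ij|A].
  have -> : '[r2v (row i Q) : U, r2v (row j Q)] =
      (Q *m gram U *m (Q^t*)%sesqui) i j.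
    rewrite innerprod_gram !r2vK -row_mul !mxE.
    by apply: eq_bigr => k _; rewrite !mxE.
  by rewrite gramE !mulmxA QP mul1mx -mulmxA PQ mulmx1 mxE (negPf neq_ij).
(* The rows of A in the basis e: the change of basis acts on the left of A by
   the inverse transpose. *)
exists (fun i => r2v (row i ((invmx Q)^T *m A))).
have {1}-> : A = Q^T *m ((invmx Q)^T *m A).
  by rewrite mulmxA -trmx_mul mulVmx ?trmx1 ?mul1mx ?unitmx_inv.
apply/matrixP => i j; rewrite mxE summxE; apply: eq_bigr => k _.
by rewrite tensE !r2vK !mxE.
Qed.

(** The quadratic form of 1 (x) g has no cross terms in an orthogonal
    decomposition, so its sign is governed by that of g. *)
Lemma tens_op1_dot (e : 'I_(dim U) -> U) (w : 'I_(dim U) -> W) (g : 'End(W)) :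
  (forall i j, i != j -> '[e i, e j] = 0) ->
  '[tens_op \1 g (\sum_i tens (e i) (w i)), \sum_i tens (e i) (w i)] =
    \sum_i '[e i, e i] * '[g (w i), w i].
Proof.
move=> e_orth; have -> : tens_op \1 g (\sum_i tens (e i) (w i)) = \sum_i tens (e i) (g (w i)).
  by rewrite linear_sum; apply: eq_bigr => i _; rewrite /= tens_opE id_lfunE.
rewrite innerprod_suml; apply: eq_bigr => i _.
rewrite innerprod_sumr (bigD1 i) // big1 => [|j neq_ji].
  by rewrite Monoid.mulm1 innerprod_tens.
by rewrite innerprod_tens e_orth 1?eq_sym // mul0r.
Qed.

Lemma tens_op1_psd (g : 'End(W)) :
  op_psd g -> op_psd (tens_op (\1 : 'End(U)) g).
Proof.
move=> [gH g_ge0]; split.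
  by rewrite /op_hermitian adjoint_tens_op adjoint1 gH.
move=> A; have [e e_orth /(_ A)[w ->]] := orthogonal_tens_decomposition.
by rewrite tens_op1_dot // sumr_ge0 // => i _; rewrite mulr_ge0 // dnorm_ge0.
Qed.

(** A sum of nonnegative terms vanishes only if each term does; each term has
    e_i = 0 or w_i = 0, so that the i-th pure tensor is 0 in either case. *)
Lemma tens_op1_pd (g : 'End(W)) : op_pd g -> op_pd (tens_op (\1 : 'End(U)) g).
Proof.
move=> [gH g_gt0]; have g_ge0 w : 0 <= '[g w, w].
  by have [->|/g_gt0/ltW//] := eqVneq w 0; rewrite innerprod0r.
have [fH f_ge0] : op_psd (tens_op (\1 : 'End(U)) g) by apply: tens_op1_psd.
split=> // A A0; rewrite lt_def f_ge0 andbT; apply: contraNneq A0.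
have [e e_orth /(_ A)[w ->]] := orthogonal_tens_decomposition.
have term_ge0 i : 0 <= '[e i, e i] * '[g (w i), w i].
  by rewrite mulr_ge0 // dnorm_ge0.
rewrite tens_op1_dot // => /eqP; rewrite psumr_eq0 // => /allP term0.
rewrite big1 // => i _; have := term0 i (mem_index_enum i).
rewrite /= mulf_eq0 dnorm_eq0 => /orP[/eqP-> | gw0]; first exact: tens0l.
have [->|/g_gt0] := eqVneq (w i) 0; first exact: tens0r.
by rewrite (eqP gw0) ltxx.
Qed.

End TensorGeometry.

(** * Operators on a Cartesian power *)

Section CartesianOperator.
Variables (C : numClosedFieldType) (m : nat) (V : unitarySpaceType C).
Implicit Types S T : 'End(V).

Lemma ffun_innerprodE (x y : {ffun 'I_m -> V}) : '[x, y] = \sum_i '[x i, y i].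
Proof. by []. Qed.

Lemma adjoint_cart_op T : adjoint (cart_op m T) = cart_op m (adjoint T).
Proof.
symmetry; apply: adjoint_unique => x y; rewrite !ffun_innerprodE.
by apply: eq_bigr => i _; rewrite !cart_opE adjointP.
Qed.

Lemma cart_op_psd T : op_psd T -> op_psd (cart_op m T).
Proof.
move=> [TH T_ge0]; split; first by rewrite /op_hermitian adjoint_cart_op TH.
by move=> x; rewrite ffun_innerprodE sumr_ge0 // => i _; rewrite cart_opE.
Qed.

Lemma cart_op_pd T : op_pd T -> op_pd (cart_op m T).
Proof.
move=> [TH T_gt0]; split=> [|x x0].
  by rewrite /op_hermitian adjoint_cart_op TH.
have T_ge0 v : 0 <= '[T v, v].
  by have [->|/T_gt0/ltW//] := eqVneq v 0; rewrite innerprod0r.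
rewrite ffun_innerprodE; under eq_bigr do rewrite cart_opE.
rewrite lt_def sumr_ge0 // andbT; apply: contraNneq x0.
move/eqP; rewrite psumr_eq0 // => /allP Tx0; apply/eqP/ffunP => i; rewrite ffunE.
apply: contraTeq (Tx0 i (mem_index_enum i)) => /T_gt0 /=.
by rewrite lt_def => /andP[].
Qed.

Definition cart_single (i : 'I_m) (v : V) : {ffun 'I_m -> V} :=
  [ffun j => if j == i then v else 0].

Lemma cart_single_sum (x : {ffun 'I_m -> V}) : x = \sum_i cart_single i (x i).
Proof.
apply/ffunP => j; rewrite sum_ffunE (bigD1 j) //= ffunE eqxx big1 ?addr0 //.
by move=> i neq_ij; rewrite ffunE eq_sym (negPf neq_ij).
Qed.

Lemma cart_single_dot i j v w :
  '[cart_single i v, cart_single j w] = if i == j then '[v, w] else 0.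
Proof.
rewrite ffun_innerprodE (bigD1 i) //= !ffunE eqxx big1 => [|k neq_ki].
  by rewrite addr0; case: eqP => // _; rewrite innerprod0r.
by rewrite !ffunE (negPf neq_ki) innerprod0l.
Qed.

Lemma cart_op_single T i v : cart_op m T (cart_single i v) = cart_single i (T v).
Proof.
by apply/ffunP => j; rewrite cart_opE !ffunE; case: eqP; rewrite ?linear0.
Qed.

Lemma cart_perm_single s i v :
  cart_perm V s (cart_single i v) = cart_single (s i) v.
Proof.
by apply/ffunP => j; rewrite cart_permE !ffunE (canF_eq (permKV s)).
Qed.

End CartesianOperator.

(** * The induced operator inherits the properties of T *)

Section InducedOperator.
Variables (C : numClosedFieldType) (m : nat) (G : {group 'S_m}).
Variables (U V : unitarySpaceType C) (X : 'S_m -> 'End(U)).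
Implicit Types S T : 'End(V).

Local Notation K := (@induced_op C m G U V X).

Lemma induced_op_comp S T : K (S \o T)%VF = (K S \o K T)%VF.
Proof.
apply/lfunP => x; apply: val_inj; rewrite comp_lfunE /= !induced_opE.
rewrite -comp_lfunE tens_op_comp comp_lfun1l; congr (tens_op _ _ _).
by apply/lfunP => y; apply/ffunP => i; rewrite comp_lfunE !cart_opE lfunE.
Qed.

Lemma induced_op1 : K \1%VF = \1%VF.
Proof.
apply/lfunP => x; apply: val_inj; rewrite /= induced_opE id_lfunE.
suff -> : tens_op (\1 : 'End(U)) (cart_op m (\1 : 'End(V))) = \1%VF.
  by rewrite lfunE.
apply: eq_tens_op => u y; rewrite tens_opE !id_lfunE; congr (tens _ _).
by apply/ffunP => i; rewrite cart_opE lfunE.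
Qed.

Lemma induced_opN T : K (- T) = - K T.
Proof.
apply/lfunP => x; apply: val_inj; rewrite opp_lfunE linearN /= !induced_opE.
suff -> : tens_op (\1 : 'End(U)) (cart_op m (- T)) = - tens_op \1 (cart_op m T).
  by rewrite opp_lfunE.
apply: eq_tens_op => u y; rewrite opp_lfunE !tens_opE /tens -mulmxN -linearN.
by congr (_ *m v2r _); apply/ffunP => i; rewrite ffunE !cart_opE opp_lfunE.
Qed.

Lemma subvs_innerprodE (x y : subvs_of (symmetry_class G V X)) :
  '[x, y] = '[vsval x, vsval y].
Proof. by []. Qed.

Lemma adjoint_induced_op T : adjoint (K T) = K (adjoint T).
Proof.
symmetry; apply: adjoint_unique => x y.
rewrite !subvs_innerprodE !induced_opE adjointP.
by rewrite adjoint_tens_op adjoint1 adjoint_cart_op.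
Qed.

Lemma induced_op_normal T : op_normal T -> op_normal (K T).
Proof. by rewrite /op_normal adjoint_induced_op -!induced_op_comp => ->. Qed.

Lemma induced_op_unitary T : op_unitary T -> op_unitary (K T).
Proof.
rewrite /op_unitary adjoint_induced_op -induced_op_comp => ->.
exact: induced_op1.
Qed.

Lemma induced_op_hermitian T : op_hermitian T -> op_hermitian (K T).
Proof. by rewrite /op_hermitian adjoint_induced_op => ->. Qed.

Lemma induced_op_skew_hermitian T :
  op_skew_hermitian T -> op_skew_hermitian (K T).
Proof.
by rewrite /op_skew_hermitian adjoint_induced_op => ->; apply: induced_opN.
Qed.

Lemma induced_op_psd T : op_psd T -> op_psd (K T).
Proof.
move=> Tpsd; split=> [|x]; first by apply: induced_op_hermitian; case: Tpsd.
rewrite subvs_innerprodE induced_opE.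
exact: (tens_op1_psd U (cart_op_psd m Tpsd)).2.
Qed.

Lemma induced_op_pd T : op_pd T -> op_pd (K T).
Proof.
move=> Tpd; split=> [|x x0]; first by apply: induced_op_hermitian; case: Tpd.
rewrite subvs_innerprodE induced_opE.
exact: (tens_op1_pd U (cart_op_pd m Tpd)).2.
Qed.

(** * A copy of V inside the symmetry class *)

(** The U-component, at position j, of the symmetrization of u (x) v placed at
    position i; it does not depend on v. *)
Definition transport_coef (u : U) (i j : 'I_m) : U :=
  #|G|%:R^-1 *: \sum_(s in G | s i == j) X s u.

Lemma symmetrizer_single u i v :
  symmetrizer G V X (tens u (cart_single i v)) =
    \sum_j tens (transport_coef u i j) (cart_single j v).
Proof.
rewrite /symmetrizer scale_lfunE sum_lfunE.
under [RHS]eq_bigr do rewrite tensZl tens_suml.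
rewrite -scaler_sumr; congr (_ *: _).
rewrite [LHS](partition_big (fun s : 'S_m => s i) xpredT) //=.
apply: eq_bigr => j _; apply: eq_bigr => s /andP[_ /eqP <-].
by rewrite tens_opE cart_perm_single.
Qed.

(** Different positions are orthogonal, so symmetrizing the tensors u (x) v_i,
    with u and i fixed, multiplies all inner products by the same factor. *)
Lemma symmetrizer_single_dot u i v w :
  '[symmetrizer G V X (tens u (cart_single i v)),
    symmetrizer G V X (tens u (cart_single i w))] =
  (\sum_j '[transport_coef u i j, transport_coef u i j]) * '[v, w].
Proof.
rewrite !symmetrizer_single innerprod_suml mulr_suml; apply: eq_bigr => j _.
rewrite innerprod_sumr (bigD1 j) // big1 => [|k neq_kj].
  by rewrite Monoid.mulm1 innerprod_tens cart_single_dot eqxx.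
by rewrite innerprod_tens cart_single_dot eq_sym (negPf neq_kj) mulr0.
Qed.

(** If no basis vector u and position i give a positive factor, the symmetrizer
    kills a spanning set, so the class and hence V are 0, and the zero map with
    factor 1 qualifies. *)
Lemma scaled_isometry_into_class :
  (symmetry_class G V X = 0%VS -> fullv = 0%VS :> {vspace V}) ->
  exists (z : V -> subvs_of (symmetry_class G V X)) (c : C),
    [/\ 0 < c, forall v w, '[z v, z w] = c * '[v, w] &
        forall T v, K T (z v) = z (T v)].
Proof.
move=> classV.
pose c u i := \sum_j '[transport_coef u i j, transport_coef u i j].
have coef_ge0 u i j : 0 <= '[transport_coef u i j, transport_coef u i j].
  exact: dnorm_ge0.
have [/existsP[k /existsP[i cN0]]|] :=
    boolP [exists k : 'I_(dim U), exists i, c (r2v 'e_k) i != 0].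
  pose u : U := r2v 'e_k.
  have memz v :
      symmetrizer G V X (tens u (cart_single i v)) \in symmetry_class G V X.
    by rewrite memv_img ?memvf.
  exists (fun v => Subvs (memz v)), (c u i); split=> [|v w|T v].
  - by rewrite lt_def cN0 sumr_ge0.
  - by rewrite subvs_innerprodE symmetrizer_single_dot.
  apply: val_inj; rewrite /= induced_opE /= -comp_lfunE -symmetrizer_comm.
  rewrite comp_lfunE.
  by rewrite tens_opE id_lfunE cart_op_single.
move=> /existsPn c0.
have single0 k i v : symmetrizer G V X (tens (r2v 'e_k) (cart_single i v)) = 0.
  have /existsPn/(_ i)/negPn := c0 k; rewrite psumr_eq0 // => /allP coef0.
  rewrite symmetrizer_single big1 // => j _.
  by have := coef0 j (mem_index_enum j); rewrite /= dnorm_eq0 => /eqP->; apply: tens0l.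
have sym0 : symmetrizer G V X = 0.
  apply/lfunP => A; rewrite zero_lfunE [A]tens_sum pair_big.
  rewrite (linear_sum (symmetrizer G V X)) big1 // => -[k l] _.
  rewrite linearZ; apply/eqP; rewrite scaler_eq0; apply/orP; right; apply/eqP.
  rewrite [X in tens _ X]cart_single_sum tens_sumr.
  by rewrite (linear_sum (symmetrizer G V X)) big1 // => i _; apply: single0.
have V0 v : v = 0 :> V.
  apply/eqP; rewrite -memv0 -classV ?memvf // /symmetry_class sym0.
  by apply/vspaceP => A; rewrite lim0g.
exists (fun=> 0), 1; split=> // [v w|T v]; last by rewrite linear0.
by rewrite (V0 v) !innerprod0l mulr0.
Qed.

(** * The induced operator reflects the properties of T *)

Section Reflection.
Hypothesis classV : symmetry_class G V X = 0%VS -> fullv = 0%VS :> {vspace V}.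
Variable T : 'End(V).

(** K(T) determines the sesquilinear form of T, since
    <K(T) z(v), z(w)> = c <Tv, w> with c > 0. *)
Lemma induced_op_inj : injective K.
Proof.
have [z [c [c0 zM zK]]] := scaled_isometry_into_class classV.
move=> S1 S2 eqK; apply/lfunP => v; apply: innerprod_injr => w.
apply: (mulfI (lt0r_neq0 c0)).
by rewrite -!zM -!zK eqK.
Qed.

Lemma induced_op_normalE : op_normal (K T) <-> op_normal T.
Proof.
split; last exact: induced_op_normal.
by rewrite /op_normal adjoint_induced_op -!induced_op_comp => /induced_op_inj.
Qed.

Lemma induced_op_unitaryE : op_unitary (K T) <-> op_unitary T.
Proof.
split; last exact: induced_op_unitary.
rewrite /op_unitary adjoint_induced_op -induced_op_comp -induced_op1.
exact: induced_op_inj.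
Qed.

Lemma induced_op_hermitianE : op_hermitian (K T) <-> op_hermitian T.
Proof.
split; last exact: induced_op_hermitian.
by rewrite /op_hermitian adjoint_induced_op => /induced_op_inj.
Qed.

Lemma induced_op_skew_hermitianE :
  op_skew_hermitian (K T) <-> op_skew_hermitian T.
Proof.
split; last exact: induced_op_skew_hermitian.
by rewrite /op_skew_hermitian adjoint_induced_op -induced_opN => /induced_op_inj.
Qed.

Lemma induced_op_psdE : op_psd (K T) <-> op_psd T.
Proof.
split=> [[KH K_ge0]|]; last exact: induced_op_psd.
split=> [|v]; first exact/induced_op_hermitianE.
have [z [c [c0 zM zK]]] := scaled_isometry_into_class classV.
by rewrite -(pmulr_rge0 _ c0) -zM -zK.
Qed.

Lemma induced_op_pdE : op_pd (K T) <-> op_pd T.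
Proof.
split=> [[KH K_gt0]|]; last exact: induced_op_pd.
split=> [|v v0]; first exact/induced_op_hermitianE.
have [z [c [c0 zM zK]]] := scaled_isometry_into_class classV.
rewrite -(pmulr_rgt0 _ c0) -zM -zK; apply: K_gt0.
by rewrite -(dnorm_eq0 innerprod) zM mulf_neq0 ?gt_eqF ?innerprod_gt0.
Qed.

End Reflection.
End InducedOperator.

Theorem theorem3p2 (R : realType) (m : nat) (G : {group 'S_m})
    (U V : unitarySpaceType R[i]) (X : 'S_m -> 'End(U))
    (X_repr : unitary_repr G X) (X_irr : irreducible_repr G X)
    (S T : 'End(V)) :
  adjoint (induced_op G X T) = induced_op G X (adjoint T)
  /\
  ((op_normal T -> op_normal (induced_op G X T)) /\
   (op_unitary T -> op_unitary (induced_op G X T)) /\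
   (op_hermitian T -> op_hermitian (induced_op G X T)) /\
   (op_skew_hermitian T -> op_skew_hermitian (induced_op G X T)) /\
   (op_psd T -> op_psd (induced_op G X T)) /\
   (op_pd T -> op_pd (induced_op G X T)))
  /\
  ((symmetry_class G V X = 0%VS -> fullv = 0%VS :> {vspace V}) ->
   (op_normal (induced_op G X T) <-> op_normal T) /\
   (op_unitary (induced_op G X T) <-> op_unitary T) /\
   (op_hermitian (induced_op G X T) <-> op_hermitian T) /\
   (op_skew_hermitian (induced_op G X T) <-> op_skew_hermitian T) /\
   (op_psd (induced_op G X T) <-> op_psd T) /\
   (op_pd (induced_op G X T) <-> op_pd T)).
Proof.
split; first exact: adjoint_induced_op.
split=> [|classV].
  split; first exact: induced_op_normal.
  split; first exact: induced_op_unitary.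
  split; first exact: induced_op_hermitian.
  split; first exact: induced_op_skew_hermitian.
  by split; [exact: induced_op_psd | exact: induced_op_pd].
split; first exact: induced_op_normalE.
split; first exact: induced_op_unitaryE.
split; first exact: induced_op_hermitianE.
split; first exact: induced_op_skew_hermitianE.
by split; [exact: induced_op_psdE | exact: induced_op_pdE].
Qed.
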